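(* Let $\omega,\omega'\in\{0,1\}^{\infty}$. The graphs $X_\omega$ and $X_{\omega'}$ are locally isomorphic if and only if either both $\omega$ and $\omega'$ are cofinal or anticofinal with $0^\infty$ (i.e. each of them is cofinal or anticofinal with $0^\infty$), or both $\omega$ and $\omega'$ are neither cofinal nor anticofinal with $0^{\infty}$. In particular, the family of graphs $X_{\omega}$, $\omega\in\{0,1\}^{\infty}$, contains precisely two graphs up to local isomorphism, for example $X_{0^{\infty}}$ and $X_{(10)^{\infty}}$.
   Context: $\{0,1\}^{\infty}$ is the set of infinite sequences $x_1x_2\ldots$ with $x_i\in\{0,1\}$; for $x\in\{0,1\}$ put $\overline{x}=1-x$; $0^\infty=000\ldots$ and $(10)^\infty=101010\ldots$. Definition of $X_\omega$. For $\omega=x_1x_2\ldots\in\{0,1\}^\infty$ and $n\ge 1$ put $a_n^{\omega}=\sum_{i=1}^n x_i2^{i-1}-2^{n-1}$. The graph $X_\omega$ is undirected with vertex set $V_\omega=\mathbb{Z}$. Its edges are those of the disjoint union $\coprod_{n\ge 0}E^n_\omega$, where $E^0_\omega=\{(z,z+1):z\in\mathbb{Z}\}$ and, for $n\ge1$, $E^n_\omega=\{(2^nz-a_n^\omega,\,2^n(z+1)-a_n^\omega):z\in\mathbb{Z}\}$; in addition, if there is a vertex not incident to any edge of $\coprod_{n\ge 1}E^n_\omega$ (there is at most one such vertex), a loop is added at that vertex. The graph $X_\omega$ is $4$-regular (a loop counts twice). Two sequences $\omega=x_1x_2\ldots$ and $\omega'=y_1y_2\ldots$ are cofinal (resp.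 anticofinal) if there exists $i_0$ such that $x_i=y_i$ (resp. $x_i=\overline{y}_i$) for every $i\ge i_0$. The ball $B(v,r)$ in a graph is the subgraph (loops included) induced by the vertices at graph distance at most $r$ from $v$. Two graphs $X$ and $Y$ are locally isomorphic if, for every ball in one graph, there exists an isomorphic ball in the other graph. *)

(* Defs.v *)
From mathcomp Require Import all_boot all_order all_algebra zify.
From mathcomp Require Import boolp classical_sets.

Set Implicit Arguments.
Unset Strict Implicit.
Unset Printing Implicit Defensive.

Import Order.TTheory GRing.Theory Num.Theory.
Local Open Scope ring_scope.
Local Open Scope classical_set_scope.

(* Undirected graphs, loops allowed; no parallel edges, which is no loss here by
   [Eset_disjoint]. *)
Record graph := Graph {
  vertex :> Type;
  adj : vertex -> vertex -> Prop;
  adj_sym : forall u v, adj u v -> adj v u }.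

Definition isomorphic (G H : graph) : Prop :=
  exists2 f : G -> H, bijective f & forall u v, adj u v <-> adj (f u) (f v).

Definition induced (G : graph) (A : set G) : graph :=
  @Graph (set_type A) (fun u v => adj (val u) (val v))
    (fun u v => @adj_sym G (val u) (val v)).

Inductive walk (G : graph) : nat -> G -> G -> Prop :=
| walk_nil u : walk 0 u u
| walk_cons n u v w : adj u v -> walk n v w -> walk n.+1 u w.

(* [dist_le u v r]: the length of a shortest walk from u to v is at most r. *)
Definition dist_le (G : graph) (u v : G) (r : nat) : Prop :=
  exists2 k : nat, (k <= r)%N & walk k u v.

Definition ball (G : graph) (v : G) (r : nat) : graph :=
  induced [set u : G | dist_le v u r].

(* The isomorphism between the two balls need not match their centers, and
   their radii are not required to be equal. *)
Definition locally_isomorphic (G H : graph) : Prop :=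
  (forall (v : G) (r : nat), exists (w : H) (s : nat),
     isomorphic (ball v r) (ball w s)) /\
  (forall (w : H) (s : nat), exists (v : G) (r : nat),
     isomorphic (ball w s) (ball v r)).

(* The sequence x_1 x_2 x_3 ... is encoded with a shift: [w i] is x_(i+1). *)
Definition bitseq_inf := nat -> bool.

Definition cofinal (w w' : bitseq_inf) : Prop :=
  exists i0 : nat, forall i : nat, (i0 <= i)%N -> w i = w' i.

Definition anticofinal (w w' : bitseq_inf) : Prop :=
  exists i0 : nat, forall i : nat, (i0 <= i)%N -> w i = ~~ w' i.

Definition zeros : bitseq_inf := fun=> false.

(* 101010..., beginning with x_1 = 1 *)
Definition onezeros : bitseq_inf := fun i => ~~ odd i.

(* Meaningful only for n >= 1. *)
Definition a_seq (w : bitseq_inf) (n : nat) : int :=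
  (\sum_(i < n) (w i)%:Z * 2 ^+ i) - 2 ^+ n.-1.

Definition Eset (w : bitseq_inf) (n : nat) : set (int * int) :=
  if n == 0%N then [set (z, z + 1) | z in [set: int]]
  else [set (2 ^+ n * z - a_seq w n, 2 ^+ n * (z + 1) - a_seq w n) | z in [set: int]].

Definition uncovered (w : bitseq_inf) (v : int) : Prop :=
  forall (n : nat) (u : int), (1 <= n)%N ->
    ~ Eset w n (v, u) /\ ~ Eset w n (u, v).

Definition X_adj (w : bitseq_inf) (u v : int) : Prop :=
  (exists n : nat, Eset w n (u, v) \/ Eset w n (v, u)) \/
  (u = v /\ uncovered w u).

Lemma X_adj_sym (w : bitseq_inf) (u v : int) : X_adj w u v -> X_adj w v u.
Proof.
case=> [[n [h|h]]|[-> h]]; [left; exists n|left; exists n|right]; by auto.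
Qed.

Definition X (w : bitseq_inf) : graph := Graph (@X_adj_sym w).

Lemma Eset_diff (w : bitseq_inf) (n : nat) (u v : int) :
  Eset w n (u, v) -> v - u = 2 ^+ n.
Proof.
rewrite /Eset; case: eqP => [->|_] [z _ [<- <-]]; first by rewrite expr0; lia.
by rewrite mulrDr mulr1; lia.
Qed.

(* No two of the sets E^n share an edge, even up to orientation, and none of
   them contains a loop: a relation loses nothing of the disjoint union. *)
Lemma Eset_disjoint (w : bitseq_inf) (m n : nat) (u v : int) :
  Eset w m (u, v) -> Eset w n (u, v) \/ Eset w n (v, u) -> m = n.
Proof.
have pos k : (0 : int) < 2 ^+ k by rewrite exprn_gt0.
move=> /Eset_diff hm [] /Eset_diff hn; have := pos m; have := pos n.
  move=> _ _; have : (2 : int) ^+ m = 2 ^+ n by rewrite -hm -hn.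
  exact: ieexprIn.
by lia.
Qed.

Lemma Eset_irrefl (w : bitseq_inf) (n : nat) (u : int) : ~ Eset w n (u, u).
Proof.
move=> /Eset_diff; rewrite subrr => /esym/eqP.
by rewrite expf_eq0 /= andbF.
Qed.

Lemma isomorphic_refl (G : graph) : isomorphic G G.
Proof. by exists id => //; exists id. Qed.

Lemma isomorphic_trans (G H K : graph) :
  isomorphic G H -> isomorphic H K -> isomorphic G K.
Proof.
move=> [f bf hf] [g bg hg]; exists (g \o f); first exact: bij_comp.
by move=> u v; rewrite hf hg.
Qed.

Lemma locally_isomorphic_refl (G : graph) : locally_isomorphic G G.
Proof. by split=> v r; exists v, r; exact: isomorphic_refl. Qed.

Lemma locally_isomorphic_sym (G H : graph) :
  locally_isomorphic G H -> locally_isomorphic H G.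
Proof. by case. Qed.

Lemma locally_isomorphic_trans (G H K : graph) :
  locally_isomorphic G H -> locally_isomorphic H K -> locally_isomorphic G K.
Proof.
move=> [h1 h2] [h3 h4]; split=> v r.
  have [w [s i1]] := h1 v r; have [x [t i2]] := h3 w s.
  by exists x, t; exact: isomorphic_trans i1 i2.
have [w [s i1]] := h4 v r; have [x [t i2]] := h2 w s.
by exists x, t; exact: isomorphic_trans i1 i2.
Qed.

(* Main.v *)
Require Import Defs.
From mathcomp Require Import all_boot all_order all_algebra.
From mathcomp Require Import boolp classical_sets.
From mathcomp Require Import zify.

(** Let [s] be the 2-adic integer [\sum_i x_(i+1) 2^i].  The edges of [E^n] at a
vertex [u] exist exactly when [u + s] has 2-adic valuation [n - 1], so [u] is
joined to [u +- 1] and [u +- 2^n], or carries a loop if [u + s = 0].  A loop thus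
exists iff [s] is an ordinary integer, iff the sequence is eventually constant,
and the ball of radius 0 at the loop separates the two classes.  If [s] and [s']
are both integers, the translation by [s - s'] is an isomorphism.  If neither is,
the valuations on a given ball are bounded by some [N], and the translation by an
integer congruent to [s - s'] modulo [2^N] maps this ball isomorphically. *)

Set Implicit Arguments.
Unset Strict Implicit.
Unset Printing Implicit Defensive.

Import Order.TTheory GRing.Theory Num.Theory.
Local Open Scope ring_scope.
Local Open Scope classical_set_scope.

(** * Walks and balls under a bijection of the vertices *)

Lemma walk_rcons (G : graph) n (u v x : G) :
  walk n u v -> adj v x -> walk n.+1 u x.
Proof.
elim=> {n u v} [u|n u v y huv _ IH] h.
  exact: walk_cons h (walk_nil _).
exact: walk_cons huv (IH h).
Qed.

Lemma walk_unrcons (G : graph) n (u x : G) :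
  walk n.+1 u x -> exists2 v, walk n u v & adj v x.
Proof.
elim: n u => [|n IH] u h; inversion h; subst.
  by inversion H1; subst; exists u => //; exact: walk_nil.
have [y hy hyx] := IH _ H1.
by exists y => //; exact: walk_cons H0 hy.
Qed.

(** A walk of length at most [r] from [v] leaves only vertices of the ball, so control of adjacency
    at these vertices suffices to transport walks. Walks in [H] are pulled back along the inverse of
    [f], peeling off their last edge. *)
Lemma isomorphic_ball (G H : graph) (f : G -> H) (v : G) (r : nat) :
  bijective f ->
  (forall u x, dist_le v u r -> (adj u x <-> adj (f u) (f x))) ->
  isomorphic (ball v r) (ball (f v) r).
Proof.
move=> [g fK gK] fadj.
have walkE k u : (k <= r)%N -> (walk k v u <-> walk k (f v) (f u)).
  elim: k u => [|k IH] u kr.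
    split=> h; inversion h; subst; first exact: walk_nil.
    rewrite (_ : u = v); first exact: walk_nil.
    by apply: (can_inj fK).
  split=> /walk_unrcons [y hy hyu].
    apply: (@walk_rcons _ _ _ (f y)); first by apply/IH => //; exact: ltnW.
    by apply/fadj => //; exists k => //; exact: ltnW.
  rewrite -(gK y) in hy hyu.
  have hgy : walk k v (g y) by apply/IH => //; exact: ltnW.
  apply: (walk_rcons hgy); apply/fadj => //.
  by exists k => //; exact: ltnW.
have distE u : dist_le v u r <-> dist_le (f v) (f u) r.
  by split=> -[k kr] h; exists k => //; apply/walkE.
have hf (u : ball v r) : f (val u) \in [set x | dist_le (f v) x r].
  by rewrite inE /=; apply/distE; have := valP u; rewrite inE.
have hg (u : ball (f v) r) : g (val u) \in [set x | dist_le v x r].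
  by rewrite inE /=; apply/distE; rewrite gK; have := valP u; rewrite inE.
exists (fun u => exist _ (f (val u)) (hf u) : ball (f v) r).
  exists (fun u => exist _ (g (val u)) (hg u) : ball v r) => u; apply: val_inj.
    exact: fK.
  exact: gK.
move=> u x /=; apply: fadj.
by have := valP u; rewrite inE.
Qed.

Lemma uniform_bound_seq (G : choiceType) (P : G -> nat -> Prop) (l : seq G) :
  (forall x m n, (m <= n)%N -> P x m -> P x n) -> (forall x, exists n, P x n) ->
  exists n, forall x, x \in l -> P x n.
Proof.
move=> Pmono /choice [f hf]; exists (\max_(x <- l) f x)%N => x xl.
exact: Pmono (leq_bigmax_seq _ xl _) (hf x).
Qed.

(** * Partial sums of s and 2-adic valuations *)

Definition psum (w : bitseq_inf) (n : nat) : int := \sum_(i < n) (w i)%:Z * 2 ^+ i.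

Lemma psumS w n : psum w n.+1 = psum w n + (w n)%:Z * 2 ^+ n.
Proof. by rewrite /psum big_ord_recr. Qed.

Lemma psum_bounds w n : 0 <= psum w n < 2 ^+ n.
Proof.
elim: n => [|n IH]; first by rewrite /psum big_ord0.
by rewrite psumS exprS; case: (w n); lia.
Qed.

Lemma pow2_dvd_psum w m n : (m <= n)%N -> (2 ^+ m %| psum w n - psum w m)%Z.
Proof.
move=> /subnK <-; elim: (n - m)%N => [|k IH]; first by rewrite subrr dvdz0.
rewrite addSn psumS addrAC rpredD // dvdz_mull //.
by rewrite exprD dvdz_mull.
Qed.

(* The 2-adic valuation of [u + s] is at least [n]. *)
Definition val_ge (w : bitseq_inf) (u : int) (n : nat) : bool :=
  (2 ^+ n %| u + psum w n)%Z.

(** Later terms of s are multiples of [2 ^+ m]. Hence divisibility by different powers can be tested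
    on one and the same integer. *)
Lemma val_ge_psum w u m n : (m <= n)%N ->
  val_ge w u m = (2 ^+ m %| u + psum w n)%Z.
Proof.
move=> /(pow2_dvd_psum w) h; rewrite /val_ge.
rewrite (_ : u + psum w n = u + psum w m + (psum w n - psum w m)); last by lia.
by rewrite (rpredDr _ h).
Qed.

Lemma val_ge_anti w u m n : (m <= n)%N -> val_ge w u n -> val_ge w u m.
Proof.
move=> mn; rewrite (val_ge_psum _ _ mn); apply: dvdz_trans.
by rewrite -(subnK mn) exprD dvdz_mull.
Qed.

Lemma val_ge0 w u : val_ge w u 0.
Proof. by rewrite /val_ge expr0 dvd1z. Qed.

Definition val_eq (w : bitseq_inf) (u : int) (n : nat) : bool :=
  val_ge w u n && ~~ val_ge w u n.+1.

Lemma val_eq_uniq w u m n : val_eq w u m -> val_eq w u n -> m = n.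
Proof.
move=> /andP[a b] /andP[c d]; apply/eqP; rewrite eqn_leq; apply/andP; split.
  by rewrite leqNgt; apply: contra d => h; exact: val_ge_anti h a.
by rewrite leqNgt; apply: contra b => h; exact: val_ge_anti h c.
Qed.

(** The sum is taken up to [n.+1] to match [a_seq w n.+1], whose term [- 2 ^+ n] is what makes the
    cofactor odd. *)
Lemma val_eqP w u n :
  val_eq w u n <-> exists z, u + psum w n.+1 = 2 ^+ n * (2 * z + 1).
Proof.
have p0 : 2 ^+ n != 0 :> int by rewrite expf_neq0.
rewrite /val_eq (val_ge_psum _ _ (leqnSn n)) /val_ge; split.
  case/andP=> /dvdzP[q ->]; rewrite (mulrC q) exprSr (dvdz_mul2l p0) => h.
  by exists (q %/ 2)%Z; congr (_ * _); lia.
case=> z ->; rewrite dvdz_mulr //= exprSr (dvdz_mul2l p0); lia.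
Qed.

(** * Edges and loops in terms of valuations *)

Lemma EsetS w n u v : Eset w n.+1 (u, v) <-> val_eq w u n /\ v = u + 2 ^+ n.+1.
Proof.
rewrite /Eset /= val_eqP /a_seq -/(psum w n.+1) /= exprS; split.
  by case=> z _ [<- <-]; split; [exists z|]; lia.
by case=> -[z hz] ->; exists z => //; congr pair; lia.
Qed.

Lemma val_eqD w u n : val_eq w (u + 2 ^+ n.+1) n = val_eq w u n.
Proof.
have E m : (m <= n.+1)%N -> val_ge w (u + 2 ^+ n.+1) m = val_ge w u m.
  by move=> mn; rewrite /val_ge addrAC rpredDr // dvdz_exp2l.
by rewrite /val_eq !E.
Qed.

Lemma EsetS_rev w n u v : Eset w n.+1 (v, u) <-> val_eq w u n /\ v = u - 2 ^+ n.+1.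
Proof.
rewrite EsetS; split=> -[h ->]; first by rewrite val_eqD addrK.
by rewrite subrK -val_eqD subrK.
Qed.

Lemma val_ge_all w u : (forall n, ~~ val_eq w u n) -> forall n, val_ge w u n.
Proof.
move=> h; elim=> [|n IH]; first exact: val_ge0.
by have := h n; rewrite /val_eq IH /= negbK.
Qed.

(** A vertex of finite valuation [n] lies on an edge of level [n.+1]; the right-hand side says that
    u + s = 0 in the 2-adic integers. *)
Lemma uncoveredP w u : uncovered w u <-> forall n, val_ge w u n.
Proof.
split=> h.
  apply: val_ge_all => n; apply/negP => hn.
  by case: (h n.+1 (u + 2 ^+ n.+1) isT) => /EsetS[].
move=> [|n] v // _; rewrite EsetS EsetS_rev /val_eq !h /=.
by split; case.
Qed.

Lemma X_adjP w u v : X_adj w u v <->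
  [\/ v = u + 1 \/ v = u - 1,
      exists2 n, val_eq w u n & v = u + 2 ^+ n.+1 \/ v = u - 2 ^+ n.+1 |
      u = v /\ forall n, val_ge w u n].
Proof.
split.
  case=> [[[|n]]|[-> /uncoveredP]].
  - by rewrite /Eset /= => -[] [z _ [<- <-]]; constructor 1; [left|right]; lia.
  - by rewrite EsetS EsetS_rev => -[] [h ->]; constructor 2; exists n => //; auto.
  - by move=> ?; constructor 3.
case=> [h|[n hn h]|[-> /uncoveredP]]; [left; exists 0%N|left; exists n.+1|by right].
  rewrite /Eset /=; case: h => ->; [left; exists u|right; exists (u - 1)] => //.
  by rewrite subrK.
by rewrite EsetS EsetS_rev; case: h => ->; auto.
Qed.

(** * Translations preserving valuations *)

Lemma X_adj_translate w w' t u x :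
  (forall n, val_ge w' (u + t) n = val_ge w u n) ->
  X_adj w u x <-> X_adj w' (u + t) (x + t).
Proof.
move=> h; rewrite !X_adjP.
have e n : val_eq w' (u + t) n = val_eq w u n by rewrite /val_eq !h.
split; case=> [hx|[n hn hx]|[hx hn]].
- by constructor 1; lia.
- by constructor 2; exists n; [rewrite e|lia].
- by constructor 3; split; [rewrite hx|move=> n; rewrite h].
- by constructor 1; lia.
- by constructor 2; exists n; [rewrite -e|lia].
- by constructor 3; split; [lia|move=> n; rewrite -h].
Qed.

(** The edges at [u] depend only on the valuation at [u], so agreement of valuations on the ball is
    enough. *)
Lemma ball_translate w w' t v r :
  (forall u, dist_le (v : X w) u r ->
     forall n, val_ge w' (u + t) n = val_ge w u n) ->
  isomorphic (ball (v : X w) r) (ball (v + t : X w') r).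
Proof.
move=> h; apply: (@isomorphic_ball (X w) (X w') (fun u => u + t)).
  exists (fun u => u - t) => u; first exact: addrK.
  exact: subrK.
by move=> u x /h; exact: X_adj_translate.
Qed.

(** * Loops and eventually constant sequences *)

Definition eventually_const (w : bitseq_inf) : Prop :=
  cofinal w zeros \/ anticofinal w zeros.

Lemma eventually_constP w :
  eventually_const w <-> exists u, forall n, val_ge w u n.
Proof.
split.
  have from i u : (forall k, val_ge w u (i + k)) -> forall n, val_ge w u n.
    by move=> h n; exact: val_ge_anti (leq_addl i n) (h n).
  case=> -[i hi].
    (* The tail vanishes, so s is [psum w i] and the witness is -s. *)
    exists (- psum w i); apply: (from i) => k.
    rewrite /val_ge (_ : psum w (i + k) = psum w i) ?addNr ?dvdz0 //.
    elim: k => [|k IH]; first by rewrite addn0.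
    by rewrite addnS psumS IH hi ?leq_addr //= mul0r addr0.
  (* A tail of ones from position [i] sums 2-adically to [- 2 ^+ i]; the witness is again -s. *)
  exists (2 ^+ i - psum w i); apply: (from i) => k.
  rewrite /val_ge (_ : psum w (i + k) = psum w i + 2 ^+ (i + k) - 2 ^+ i).
    by rewrite [X in (_ %| X)%Z](_ : _ = 2 ^+ (i + k)) ?dvdzz //; lia.
  elim: k => [|k IH]; first by rewrite addn0 addrK.
  by rewrite addnS psumS IH hi ?leq_addr //= mul1r exprS; lia.
case=> u hu.
have ltn2 (n : nat) : n%:Z < 2 ^+ n.
  by rewrite -natz -natrX ltr_nat ltn_expl.
(* [2 ^+ n] divides [u + psum w n], which lies strictly between [- 2 ^+ n] and [2 ^+ n]
   if [u <= 0], between [0] and [2 ^+ n.+1] otherwise. *)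
have E n : (`|u| <= n)%N -> u + psum w n = if u <= 0 then 0 else 2 ^+ n.
  move=> un; have := hu n; rewrite /val_ge => /dvdzP[q hq].
  have := psum_bounds w n; have := ltn2 n; rewrite hq.
  case: ifP => u0 h1 /andP[h2 h3].
    have [q0|q0|->] := ltgtP q 0; last by rewrite mul0r.
      have : q * 2 ^+ n <= - 2 ^+ n by nia.
      by lia.
    have : 2 ^+ n <= q * 2 ^+ n by nia.
    by lia.
  have [q0|q0|->] := ltgtP q 1; last by rewrite mul1r.
    have : q * 2 ^+ n <= 0 by nia.
    by lia.
  have : 2 ^+ n + 2 ^+ n <= q * 2 ^+ n by nia.
  by lia.
(* Subtracting [E n] from [E n.+1] leaves the digit [w n] times [2 ^+ n]: it is 0 if [u <= 0] and 1
   otherwise. *)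
case: (boolP (u <= 0)) => u0; [left|right]; exists `|u|%N => n hn.
all: have := E n hn; have := E n.+1 (leqW hn); have := ltn2 n.
all: rewrite psumS exprS ?u0 ?(negbTE u0) /zeros; case: (w n) => //=; lia.
Qed.

(** * Bounded valuations on balls *)

Lemma val_bounded w u :
  ~ eventually_const w -> exists n, ~~ val_ge w u n.
Proof.
move=> hw; apply: contrapT => h; apply: hw; apply/eventually_constP.
by exists u => n; apply: contrapT => /negP hn; apply: h; exists n.
Qed.

(** Local finiteness lets a bound on valuations pass from radius [r] to [r.+1]. *)
Lemma X_neighbors_finite w u :
  exists l : seq int, forall x, X_adj w u x -> x \in l.
Proof.
have [[n hn]|h] := pselect (exists n, val_eq w u n).
  exists [:: u + 1; u - 1; u + 2 ^+ n.+1; u - 2 ^+ n.+1] => x.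
  case/X_adjP => [[]->|[m hm hx]|[_ h]]; rewrite !inE ?eqxx ?orbT //.
    by rewrite (val_eq_uniq hn hm); case: hx => ->; rewrite eqxx ?orbT.
  by case/andP: hn => _; rewrite h.
exists [:: u + 1; u - 1; u] => x.
case/X_adjP => [[]->|[m hm hx]|[-> _]]; rewrite !inE ?eqxx ?orbT //.
by case: h; exists m.
Qed.

Lemma val_bounded_ball w r v : ~ eventually_const w ->
  exists N, forall u, dist_le (v : X w) u r -> ~~ val_ge w u N.
Proof.
move=> hw; elim: r v => [|r IH] v.
  have [N hN] := val_bounded v hw; exists N => u [k].
  by rewrite leqn0 => /eqP -> h; inversion h; subst.
have [l hl] := X_neighbors_finite w v.
have [|N hN] := uniform_bound_seq l _ IH.
  by move=> x m n mn h u /h; apply: contra; exact: val_ge_anti.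
have [M hM] := val_bounded v hw.
(* [M] serves the centre [v], and [N] the balls of radius [r] around its neighbours, which contain
   every endpoint of a nonempty walk. *)
exists (maxn M N) => u [[|k] kr] h; inversion h; subst.
  by apply: contra hM; apply: val_ge_anti; exact: leq_maxl.
have : ~~ val_ge w u N by apply: (hN _ (hl _ H0)); exists k.
by apply: contra; apply: val_ge_anti; exact: leq_maxr.
Qed.

(** * Copying balls from one graph to another *)

Lemma ball_embed_const w w' v r : eventually_const w -> eventually_const w' ->
  exists v', isomorphic (ball (v : X w) r) (ball (v' : X w') r).
Proof.
move=> /eventually_constP[a ha] /eventually_constP[a' ha'].
(* Here s = -a and s' = -a', so this is the translation by s - s'. *)
exists (v + (a' - a)); apply: ball_translate => u _ n.
have := ha n; have := ha' n; rewrite /val_ge => h' h.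
rewrite (_ : u + (a' - a) + _ = (u - a) + (a' + psum w' n)); last by lia.
rewrite [in RHS](_ : u + _ = (u - a) + (a + psum w n)); last by lia.
by rewrite (rpredDr _ h') (rpredDr _ h).
Qed.

Lemma ball_embed_nonconst w w' v r : ~ eventually_const w ->
  exists v', isomorphic (ball (v : X w) r) (ball (v' : X w') r).
Proof.
move=> hw; have [N hN] := val_bounded_ball r v hw.
(* The shift is congruent to s - s' modulo [2 ^+ N]. *)
exists (v + (psum w N - psum w' N)); apply: ball_translate => u hu.
have E n : (n <= N)%N ->
    val_ge w' (u + (psum w N - psum w' N)) n = val_ge w u n.
  by move=> nN; rewrite !(val_ge_psum _ _ nN) -addrA subrK.
(* Beyond [N] both sides are false, since divisibility by [2 ^+ N] already fails for both. *)
move=> n; have [/E //|/ltnW Nn] := leqP n N.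
have h := hN u hu; have h' := h; rewrite -E // in h'.
by rewrite (negbTE (contra (val_ge_anti Nn) h)) (negbTE (contra (val_ge_anti Nn) h')).
Qed.

(** * The two classes up to local isomorphism *)

Lemma locally_isomorphic_const w w' : locally_isomorphic (X w) (X w') ->
  eventually_const w -> eventually_const w'.
Proof.
move=> [h _] /eventually_constP[a ha].
have [b [s [f _ fadj]]] := h (a : X w) 0%N.
have a0 : a \in [set u | dist_le (a : X w) u 0].
  by rewrite inE; exists 0%N => //; exact: walk_nil.
pose a1 : ball (a : X w) 0 := exist _ a a0.
have : adj a1 a1 by apply/X_adjP; constructor 3.
(* The image of the loop is a loop, and no [Eset] contains one, so the image vertex is uncovered. *)
move=> /fadj /= [[n [|] /Eset_irrefl //]|[_ /uncoveredP hu]].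
by apply/eventually_constP; exists (val (f a1)).
Qed.

Lemma locally_isomorphicP w w' : locally_isomorphic (X w) (X w') <->
  (eventually_const w <-> eventually_const w').
Proof.
split=> [h|h].
  split; apply: locally_isomorphic_const => //.
  exact: locally_isomorphic_sym.
have half w1 w2 : (eventually_const w1 <-> eventually_const w2) ->
    forall v r, exists v' s, isomorphic (ball (v : X w1) r) (ball (v' : X w2) s).
  move=> h12 v r; have [c|c] := pselect (eventually_const w1).
    by have [v' ?] := ball_embed_const v r c (h12.1 c); exists v', r.
  by have [v' ?] := ball_embed_nonconst w2 v r c; exists v', r.
by split; apply: half => //; split=> /h.
Qed.

Lemma eventually_const_zeros : eventually_const zeros.
Proof. by left; exists 0%N. Qed.

Lemma onezeros_not_eventually_const : ~ eventually_const onezeros.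
Proof.
case=> -[i hi]; have := hi i (leqnn i); have := hi i.+1 (leqnSn i).
all: by rewrite /onezeros /zeros /=; case: (odd i).
Qed.

Theorem theorem6 :
  (forall w w' : bitseq_inf,
     locally_isomorphic (X w) (X w') <->
     ((cofinal w zeros \/ anticofinal w zeros) /\
      (cofinal w' zeros \/ anticofinal w' zeros)) \/
     (~ (cofinal w zeros \/ anticofinal w zeros) /\
      ~ (cofinal w' zeros \/ anticofinal w' zeros))) /\
  (~ locally_isomorphic (X zeros) (X onezeros) /\
   forall w : bitseq_inf,
     locally_isomorphic (X w) (X zeros) \/
     locally_isomorphic (X w) (X onezeros)).
Proof.
have z := eventually_const_zeros; have oz := onezeros_not_eventually_const.
split=> [w w'|].
  rewrite locally_isomorphicP -/(eventually_const w) -/(eventually_const w').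
  have [|] := pselect (eventually_const w); tauto.
split=> [|w]; first by rewrite locally_isomorphicP; tauto.
rewrite !locally_isomorphicP.
have [|] := pselect (eventually_const w); tauto.
Qed.
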